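(* Let $M_1,\dots,M_n$ be DFAs over a common alphabet $\Sigma$, and let $G$ be the labeled graph constructed from them as described in the context. Then $\bigcup_{i=1}^n L(M_i)=\Sigma^*$ if and only if $X_G$ has a deterministic presentation with $2$ vertices.
   Context: A labeled graph has finite vertex and edge sets, edges with initial/terminal vertices and labels; loops and multiple edges allowed. $X_G$ is the set of label sequences of bi-infinite paths in $G$. A presentation of a shift space $X$ is a labeled graph $P$ that is essential (every vertex has at least one incoming and one outgoing edge) with $X_P=X$; it is deterministic if no vertex has two outgoing edges with the same label. A DFA $M_i$ has finite state set $Q_i$ (pairwise disjoint), total transition function $\delta_i\colon Q_i\times\Sigma\to Q_i$ (viewed as edges $q\to\delta_i(q,a)$ labeled $a$), initial state $s_i$, accepting set $F_i$; $L(M_i)=\{w\in\Sigma^*:\delta_i(s_i,w)\in F_i\}$. Let $\star,\ell,\lhd,\rhd$ be distinct symbols not in $\Sigma$. $G$: a vertex $t$ with a self loop labeled $\star$; a vertex $s^*$ with a self loop labeled $a$ for each $a\in\Sigma\cup\{\ell\}$ and an edge labeled $\rhd$ from $s^*$ to $t$; for each $i$, embed $M_i$, add for each $q\in Q_i$ an edge labeled $\lhd$ from $q$ to $s_i$ and a self loop labeled $\ell$ at $q$, and for each $q\in F_i$ an edge labeled $\rhd$ from $q$ to $t$. *)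

(* Defs.v *)
From HB Require Import structures.
From mathcomp Require Import all_boot all_order all_algebra.
From mathcomp Require Import classical_sets.

Set Implicit Arguments.
Unset Strict Implicit.
Unset Printing Implicit Defensive.

Local Open Scope classical_set_scope.

Record lgraph (A : Type) := LGraph {
  vertex : finType;
  edge : finType;
  init_vertex : edge -> vertex;
  term_vertex : edge -> vertex;
  label : edge -> A }.

Definition biinf_path (A : Type) (G : lgraph A) (p : int -> edge G) : Prop :=
  forall k : int, term_vertex (p k) = init_vertex (p (k + 1)%R).

Definition shift_of (A : Type) (G : lgraph A) : set (int -> A) :=
  [set x | exists2 p : int -> edge G,
             biinf_path p & forall k, x k = label (p k)].

Definition essential (A : Type) (G : lgraph A) : Prop :=
  forall v : vertex G,
    (exists e : edge G, term_vertex e = v) /\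
    (exists e : edge G, init_vertex e = v).

Definition deterministic (A : Type) (G : lgraph A) : Prop :=
  forall e f : edge G,
    init_vertex e = init_vertex f -> label e = label f -> e = f.

Definition presentation (A : Type) (P : lgraph A) (X : set (int -> A)) : Prop :=
  essential P /\ shift_of P = X.

Record dfa (Sigma : finType) := DFA {
  state : finType;
  delta : state -> Sigma -> state;
  start : state;
  accepting : {set state} }.

Definition language (Sigma : finType) (M : dfa Sigma) : set (seq Sigma) :=
  [set w | foldl (@delta Sigma M) (start M) w \in accepting M].

Inductive symbol (Sigma : Type) :=
  | Letter of Sigma
  | Star
  | Ell
  | Lhd
  | Rhd.
Arguments Star {Sigma}.
Arguments Ell {Sigma}.
Arguments Lhd {Sigma}.
Arguments Rhd {Sigma}.

Definition symbol_code (Sigma : Type) (c : symbol Sigma) : Sigma + 'I_4 :=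
  match c with
  | Letter a => inl a
  | Star => inr (inord 0)
  | Ell => inr (inord 1)
  | Lhd => inr (inord 2)
  | Rhd => inr (inord 3)
  end.

Definition symbol_decode (Sigma : Type) (c : Sigma + 'I_4) : symbol Sigma :=
  match c with
  | inl a => Letter a
  | inr k => nth Rhd [:: Star; Ell; Lhd] k
  end.

Lemma symbol_codeK (Sigma : Type) :
  cancel (@symbol_code Sigma) (@symbol_decode Sigma).
Proof. by case=> //=; rewrite inordK. Qed.

HB.instance Definition _ (Sigma : finType) :=
  Finite.copy (symbol Sigma) (can_type (@symbol_codeK Sigma)).

Section Construction.
Variables (Sigma : finType) (n : nat) (M : 'I_n -> dfa Sigma).

(* The dependent pair makes the state sets of the automata disjoint. *)
Definition dfa_state : finType := {i : 'I_n & state (M i)}.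

(* [None] is t, [Some None] is s^*, and [Some (Some q)] is the state q. *)
Definition G_vertex : finType := option (option dfa_state).

Definition G_adj (u : G_vertex) (c : symbol Sigma) (v : G_vertex) : bool :=
  match u, c with
  | None, Star => v == None
  | Some None, (Letter _ | Ell) => v == Some None
  | Some None, Rhd => v == None
  | Some (Some (existT i q)), Letter a =>
      v == Some (Some (Tagged (fun i => state (M i)) (delta q a)))
  | Some (Some (existT i _)), Lhd =>
      v == Some (Some (Tagged (fun i => state (M i)) (start (M i))))
  | Some (Some _), Ell => v == u
  | Some (Some (existT i q)), Rhd => (q \in accepting (M i)) && (v == None)
  | _, _ => false
  end.

(* No two edges of G share both endpoints and label, so an edge of G is
   faithfully encoded by its (initial vertex, label, terminal vertex) triple. *)
Definition G_edge : finType :=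
  {e : G_vertex * symbol Sigma * G_vertex | G_adj e.1.1 e.1.2 e.2}.

Definition G_of : lgraph (symbol Sigma) :=
  @LGraph (symbol Sigma) G_vertex G_edge
    (fun e => (val e).1.1) (fun e => (val e).2) (fun e => (val e).1.2).

End Construction.

(* Main.v *)
(** Collapsing all vertices of [G] other than [t] gives a two-vertex graph in
    which every symbol labels exactly one edge.  If every word is accepted, this
    graph presents [X_G]: a point of its shift that contains [Lhd] lifts to a
    single automaton [M i], because a total automaton has a run on every
    bi-infinite word (compactness), and the run passes the possible [Rhd] if [i]
    is chosen to accept the letters read since the last [Lhd].
    Conversely, in a two-vertex presentation the source and the target of an
    [Rhd]-edge are different, and forbidden words of length two force [Lhd] and
    all letters to label loops at the source.  Hence all the words
    [Lhd w Rhd] occur in [X_G], that is, each [w] is accepted by some [M i]. *)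
Require Import Defs.
From mathcomp Require Import all_boot all_order all_algebra.
From mathcomp Require Import boolp classical_sets.

Set Implicit Arguments.
Unset Strict Implicit.
Unset Printing Implicit Defensive.

Local Open Scope classical_set_scope.

(** * Compactness: orbits of maps of a finite set along the integers *)

(** If every [t] failed at some index, no witness would be left at the largest of these finitely
    many indices. *)
Lemma fin_antitone_witness (T : finType) (P : nat -> T -> Prop) :
    (forall N t, P N.+1 t -> P N t) -> (forall N, exists t, P N t) ->
  exists t, forall N, P N t.
Proof.
move=> Pdec Pex; apply: contrapT => noP.
have /fin_all_exists[f fP] t : exists N, ~ P N t.
  apply: contrapT => nP; apply: noP; exists t => N.
  by apply: contrapT => PN; apply: nP; exists N.
have Pmono t d N : P (d + N)%N t -> P N t.
  by elim: d => // d IHd; rewrite addSn => /Pdec.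
have [t Pt] := Pex (\max_t f t)%N; apply: (fP t).
apply: (Pmono t (\max_t f t - f t)%N); rewrite subnK //.
exact: leq_bigmax.
Qed.

Fixpoint compose_from (T : Type) (g : nat -> T -> T) (m N : nat) : T -> T :=
  if N is N'.+1 then fun s => g m (compose_from g m.+1 N' s) else id.

Lemma compose_fromSr (T : Type) (g : nat -> T -> T) (m N : nat) (s : T) :
  compose_from g m N.+1 s = compose_from g m N (g (m + N)%N s).
Proof.
elim: N m s => [|N IHN] m s; first by rewrite addn0.
by rewrite [LHS]/= -[g m.+1 _]/(compose_from g m.+1 N.+1 s) IHN addnS -addSn.
Qed.

(** A form of König's lemma: the orbit is built from points that lie in the images of all finite
    compositions. *)
Lemma backward_orbit (T : finType) (t0 : T) (g : nat -> T -> T) :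
  exists y : nat -> T, forall m, y m = g m (y m.+1).
Proof.
pose good m t := forall N, exists s, compose_from g m N s = t.
have [t good_t] : exists t, good 0%N t.
  apply: fin_antitone_witness => [N t [s <-]|N].
    by exists (g (0 + N)%N s); rewrite compose_fromSr.
  by exists (compose_from g 0 N t0), t0.
(* Goodness is a premise inside the existential, so that [choice] applies to all pairs. *)
have step (mt : nat * T) : exists t', good mt.1 mt.2 ->
    mt.2 = g mt.1 t' /\ good mt.1.+1 t'.
  case: mt => m u /=; have [good_u|] := pselect (good m u); last by exists u.
  have [t' t'P] : exists t', forall N,
      u = g m t' /\ exists s, compose_from g m.+1 N s = t'.
    apply: fin_antitone_witness => [N t' [-> [s <-]]|N].
      by split=> //; exists (g (m.+1 + N)%N s); rewrite compose_fromSr.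
    have [s <-] := good_u N.+1.
    by exists (compose_from g m.+1 N s); split=> //; exists s.
  by exists t' => _; split=> [|N]; [case: (t'P 0%N) | case: (t'P N)].
have [h hP] := choice step.
pose y := fix y m := if m is m'.+1 then h (m', y m') else t.
have good_y m : good m (y m).
  by elim: m => // m IHm; case: (hP (m, y m) IHm).
by exists y => m; case: (hP (m, y m) (good_y m)).
Qed.

Lemma NegzS_add1 m : (Negz m.+1 + 1 = Negz m)%R.
Proof. by rewrite !NegzE -[m.+2]addn1 PoszD GRing.opprD GRing.addrNK. Qed.

Lemma biinf_orbit (T : finType) (t0 : T) (f : int -> T -> T) :
  exists z : int -> T, forall k, z (k + 1)%R = f k (z k).
Proof.
have [y yP] := backward_orbit t0 (fun m => f (Negz m)).
pose fw := fix fw m := if m is m'.+1 then f (Posz m') (fw m') else y 0%N.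
(* [y m] sits at the integer [-m]; the map from [y m.+1] to [y m] is thus the one at [-(m+1)], that
   is, [Negz m]. *)
exists (fun k => match k with Posz m => fw m | Negz m => y m.+1 end).
case=> [m|[|m]].
- by rewrite -PoszD addn1.
- exact: yP.
- by rewrite NegzS_add1; exact: yP.
Qed.

Lemma essential_path (A : Type) (G : lgraph A) (e f : edge G) :
    essential G -> term_vertex e = init_vertex f ->
  exists p : int -> edge G, [/\ biinf_path p, p 0%R = e & p 1%R = f].
Proof.
move=> essG ef.
have /fin_all_exists[prev prevP] v : exists e : edge G, term_vertex e = v.
  by case: (essG v).
have /fin_all_exists[next nextP] v : exists e : edge G, init_vertex e = v.
  by case: (essG v).
pose fw m := iter m (fun e => next (term_vertex e)) f.
pose bw m := iter m (fun e => prev (init_vertex e)) e.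
exists (fun k => match k with
  | Posz 0 => e | Posz m.+1 => fw m | Negz m => bw m.+1 end).
split=> // -[[|m]|[|m]] //.
- by rewrite -PoszD addn1 /= nextP.
- by rewrite /= prevP.
- by rewrite NegzS_add1 /= prevP.
Qed.

(** * The collapsed graph and the shift of [G] *)

Section Construction.
Variables (Sigma : finType) (n : nat) (M : 'I_n -> dfa Sigma).

Local Notation vtx := (G_vertex M).
Local Notation adj := (@G_adj Sigma n M).
Local Notation inM i q := (Some (Some (existT (fun j => state (M j)) i q))).

(** The sink is [t]. In [G] the label alone decides whether an edge starts at [t], and whether it
    ends there. *)
Definition leaves_sink (c : symbol Sigma) : bool :=
  if c is Star then true else false.

Definition enters_sink (c : symbol Sigma) : bool :=
  if c is (Star | Rhd) then true else false.

Lemma shift_of_GP (x : int -> symbol Sigma) :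
  shift_of (G_of M) x <->
  exists v : int -> vtx, forall k, adj (v k) (x k) (v (k + 1)%R).
Proof.
split=> [[p pP xE]|[v vP]].
  exists (fun k => (val (p k)).1.1) => k.
  rewrite xE -[X in adj _ _ X]/(init_vertex (p (k + 1)%R)) -(pP k).
  exact: (valP (p k)).
by exists (fun k => Sub (v k, x k, v (k + 1)%R) (vP k) : G_edge M).
Qed.

Lemma G_adj_init (u v : vtx) c : adj u c v -> (u == None) = leaves_sink c.
Proof. by case: u => [[[i q]|]|]; case: c. Qed.

Lemma G_adj_term (u v : vtx) c :
  adj u c v -> (v == None) = enters_sink c.
Proof.
by case: u => [[[i q]|]|]; case: c => [a||||] //=;
  first [move/eqP-> | case/andP=> _ /eqP->].
Qed.

(** [true] stands for [t], [false] for all other vertices merged. With the symbols themselves as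
    edges, determinism is immediate. *)
Definition collapsed_graph : lgraph (symbol Sigma) :=
  @LGraph (symbol Sigma) bool (symbol Sigma)
    leaves_sink enters_sink id.

Lemma shift_of_collapsedP (x : int -> symbol Sigma) :
  shift_of collapsed_graph x <->
  forall k, enters_sink (x k) = leaves_sink (x (k + 1)%R).
Proof.
split=> [[p pP xE] k|xP]; last by exists x.
by rewrite !xE; exact: pP.
Qed.

Lemma shift_of_G_collapsed : shift_of (G_of M) `<=` shift_of collapsed_graph.
Proof.
move=> x /shift_of_GP[v vP]; apply/shift_of_collapsedP => k.
by rewrite -(G_adj_term (vP k)) (G_adj_init (vP (k + 1)%R)).
Qed.

(** The symbols [Star] and [Rhd] act as the identity, like [Ell], so that a run exists along the
    whole point, even beyond [Rhd]. *)
Definition dfa_step (i : 'I_n) (c : symbol Sigma) (q : state (M i)) :=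
  match c with
  | Letter a => delta q a
  | Lhd => start (M i)
  | _ => q
  end.

(* The word [w] consists of the letters read since the last [Lhd]; it does not
   depend on the automaton. *)
Lemma dfa_step_reset (x : int -> symbol Sigma) (j : int) (m : nat) :
    x j = Lhd ->
  exists w : seq Sigma, forall i (z : int -> state (M i)),
    (forall k, z (k + 1)%R = dfa_step (x k) (z k)) ->
    z (j + 1 + m%:Z)%R = foldl (@delta Sigma (M i)) (start (M i)) w.
Proof.
move=> xj; elim: m => [|m [w IHm]].
  by exists [::] => i z zP; rewrite GRing.addr0 zP xj.
case xE: (x (j + 1 + m%:Z)%R) => [a||||].
- by exists (rcons w a) => i z zP;
    rewrite -addn1 PoszD GRing.addrA zP xE /= foldl_rcons (IHm i z zP).
- by exists w => i z zP; rewrite -addn1 PoszD GRing.addrA zP xE /= IHm.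
- by exists w => i z zP; rewrite -addn1 PoszD GRing.addrA zP xE /= IHm.
- by exists [::] => i z zP; rewrite -addn1 PoszD GRing.addrA zP xE.
- by exists w => i z zP; rewrite -addn1 PoszD GRing.addrA zP xE /= IHm.
Qed.

(** [Rhd] leads to the sink, and the only edge that leaves the sink is its [Star] loop. *)
Lemma collapsed_Star_after_Rhd (x : int -> symbol Sigma) (K k : int) :
  shift_of collapsed_graph x -> x K = Rhd -> (K < k)%R -> x k = Star.
Proof.
move=> /shift_of_collapsedP xP xK.
rewrite -lezD1 -Num.Theory.subr_ge0 => Kk.
rewrite -[k](GRing.subrK (K + 1)%R) GRing.addrC.
case: (k - (K + 1))%R Kk => // m _.
suff : leaves_sink (x (K + 1 + m%:Z)%R) by case: (x _).
elim: m => [|m IHm]; first by rewrite GRing.addr0 -xP xK.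
by rewrite -addn1 PoszD GRing.addrA -xP; case: (x _) IHm.
Qed.

Lemma collapsed_sub_shift_of_G : (0 < n)%N ->
  \bigcup_(i : 'I_n) language (M i) = [set: seq Sigma] ->
  shift_of collapsed_graph `<=` shift_of (G_of M).
Proof.
move=> n_gt0 langT x xX; have /shift_of_collapsedP xP := xX.
(* [z] gives the vertex off the sink, with [None] for [s^*]; its value is ignored where [Star] is
   read. *)
suff [z zP] : exists z : int -> option (dfa_state M),
    forall k, match x k with
      | Star => true
      | Rhd => adj (Some (z k)) Rhd None
      | c => adj (Some (z k)) c (Some (z (k + 1)%R))
      end.
  apply/shift_of_GP; exists (fun k => if leaves_sink (x k) then None else Some (z k)).
  by move=> k; rewrite -xP; move: (zP k); case: (x k).
have [[j xj]|noLhd] := pselect (exists j, x j = Lhd); last first.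
  (* Without [Lhd], the vertex [s^*] reads everything up to the sink. *)
  exists (fun=> None) => k; case xE: (x k) => [a||||] //=.
  by case: noLhd; exists k.
suff [i iP] : exists i, forall z : int -> state (M i),
    (forall k, z (k + 1)%R = dfa_step (x k) (z k)) ->
    forall k, x k = Rhd -> z k \in accepting (M i).
  have [z zP] := biinf_orbit (start (M i)) (fun k => dfa_step (x k)).
  exists (fun k => Some (existT (fun i => state (M i)) i (z k))) => k.
  move: (zP k); case xE: (x k) => [a||||] //= zk; rewrite ?zk ?eqxx ?andbT //.
  exact: iP.
have [[K xK]|noRhd] := pselect (exists K, x K = Rhd); last first.
  by exists (Ordinal n_gt0) => z _ k xk; case: noRhd; exists k.
have uniqK k : x k = Rhd -> k = K.
  move=> xk; case: (Order.TotalTheory.ltgtP k K) => // lt_k.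
    by move: xK; rewrite (collapsed_Star_after_Rhd (K:=k)).
  by move: xk; rewrite (collapsed_Star_after_Rhd (K:=K)).
have jK : (j < K)%R.
  case: (Order.TotalTheory.ltgtP j K) => // [lt_K|eq_jK].
    by move: xj; rewrite (collapsed_Star_after_Rhd (K:=K)).
  by move: xj; rewrite eq_jK xK.
have [m KE] : exists m : nat, K = (j + 1 + m%:Z)%R.
  move: jK; rewrite -lezD1 -Num.Theory.subr_ge0 => jK.
  exists (absz (K - (j + 1))%R); rewrite gez0_abs //.
  by rewrite GRing.addrC GRing.subrK.
(* The same [w] serves all automata, so [i] can be chosen to accept it before a run is fixed. *)
have [w wP] := dfa_step_reset m xj.
have [i _ wi] : (\bigcup_(i : 'I_n) language (M i)) w by rewrite langT.
exists i => z zP k /uniqK->.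
by rewrite KE (wP i z zP).
Qed.

Lemma collapsed_presentation : (0 < n)%N ->
  \bigcup_(i : 'I_n) language (M i) = [set: seq Sigma] ->
  presentation collapsed_graph (shift_of (G_of M)).
Proof.
move=> n_gt0 langT; split.
  by case; split; [exists Star | exists Star | exists Ell | exists Ell].
apply/seteqP; split; last exact: shift_of_G_collapsed.
exact: collapsed_sub_shift_of_G.
Qed.

(** * Presentations with two vertices *)

Section TwoVertices.
Variable P : lgraph (symbol Sigma).
Hypotheses (n_gt0 : (0 < n)%N) (Ppres : presentation P (shift_of (G_of M))).
Hypothesis P2 : #|vertex P| = 2%N.

Lemma presentation_edge (x : int -> symbol Sigma) (k : int) :
  shift_of (G_of M) x -> exists e : edge P, label e = x k.
Proof. by case: Ppres => _ <- [p _ xE]; exists (p k). Qed.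

(** Since [P] is essential, two consecutive edges extend to a bi-infinite path, so their labels
    occur side by side in a point of the shift. *)
Lemma presentation_Star_iff (e f : edge P) :
  term_vertex e = init_vertex f ->
  enters_sink (label e) = leaves_sink (label f).
Proof.
have [essP shiftE] := Ppres; move=> /(essential_path essP)[p [pP <- <-]].
have : shift_of (G_of M) (fun k => label (p k)) by rewrite -shiftE; exists p.
by move=> /shift_of_G_collapsed/shift_of_collapsedP/(_ 0%R).
Qed.

Lemma edge_labelled_Rhd : exists e : edge P, label e = Rhd.
Proof.
pose x (k : int) : symbol Sigma :=
  match k with Posz 0 => Rhd | Posz _ => Star | Negz _ => Ell end.
apply: (@presentation_edge x 0%R); apply/shift_of_GP.
exists (fun k => match k with Posz m.+1 => None | _ => Some None end).
by case=> [[|m]|[|m]].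
Qed.

(** Only states of the automata read [Lhd], hence the appeal to [n_gt0]. *)
Lemma edge_labelled_Lhd : exists e : edge P, label e = Lhd.
Proof.
apply: (@presentation_edge (fun=> Lhd) 0%R); apply/shift_of_GP.
by exists (fun=> inM (Ordinal n_gt0) (start (M (Ordinal n_gt0)))) => k /=.
Qed.

Lemma edge_labelled_Letter a : exists e : edge P, label e = Letter a.
Proof.
apply: (@presentation_edge (fun=> Letter a) 0%R); apply/shift_of_GP.
by exists (fun=> Some None).
Qed.

(** As [Rhd Rhd] is forbidden, [r] joins the two different vertices. Only [Star] can follow [Rhd],
    so [e] does not start at the target of [r]. If it ended there, a [Star] edge would follow it,
    although only [Star] and [Rhd] can precede [Star]. *)
Lemma presentation_loop (r e : edge P) : label r = Rhd ->
    ~~ enters_sink (label e) ->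
  init_vertex e = init_vertex r /\ term_vertex e = init_vertex r.
Proof.
move=> rR eN; have [essP _] := Ppres.
have ruv : init_vertex r != term_vertex r.
  by apply/eqP => /esym/presentation_Star_iff; rewrite rR.
have two v : v = init_vertex r \/ v = term_vertex r.
  have : v \in [set init_vertex r; term_vertex r]%SET.
    suff -> : [set init_vertex r; term_vertex r]%SET = [set: vertex P]%SET.
      by [].
    by apply/eqP; rewrite eqEcard finset.subsetT cardsT P2 cards2 ruv.
  by rewrite !inE => /orP[]/eqP; [left | right].
split.
  case: (two (init_vertex e)) => // /esym/presentation_Star_iff.
  by move: eN; rewrite rR; case: (label e).
case: (two (term_vertex e)) => // eE.
have [_ [f fE]] := essP (term_vertex r).
have := presentation_Star_iff (esym fE).
have := presentation_Star_iff (etrans eE (esym fE)).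
by rewrite rR (negbTE eN) => <-.
Qed.

Lemma presentation_language :
  \bigcup_(i : 'I_n) language (M i) = [set: seq Sigma].
Proof.
rewrite -subTset => w _; have [essP shiftE] := Ppres.
have [r rR] := edge_labelled_Rhd.
have [l lL] := edge_labelled_Lhd.
have /fin_all_exists[g gE] := edge_labelled_Letter.
have [l1 l2] : init_vertex l = init_vertex r /\ term_vertex l = init_vertex r.
  by apply: (presentation_loop rR); rewrite lL.
have gP a :
    init_vertex (g a) = init_vertex r /\ term_vertex (g a) = init_vertex r.
  by apply: (presentation_loop rR); rewrite gE.
have /fin_all_exists[next nextP] v : exists e : edge P, init_vertex e = v.
  by case: (essP v).
pose tail m := iter m (fun e => next (term_vertex e)) r.
(* The path reads [Lhd] up to position -1, then [w], then [Rhd] at position [size w], where [tail 0]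
   is [r]. *)
pose p (k : int) : edge P := match k with
  | Negz _ => l
  | Posz m => nth (tail (m - size w)%N) (map g w) m
  end.
have pP : biinf_path p.
  case=> [m|[|m]].
  - rewrite -PoszD addn1 /=; case: (ltngtP m.+1 (size w)) => [lt_m|lt_m|eq_m].
    + have lt_m' := ltnW lt_m.
      (* Splitting [w] only supplies a letter as the default value for [nth_map]. *)
      case: w lt_m lt_m' @p => // a w' lt_m lt_m' _.
      by rewrite !(nth_map a) // (gP _).2 (gP _).1.
    + rewrite !nth_default ?size_map // ?(ltnW lt_m) // subSn //.
      by rewrite /= nextP.
    + rewrite [in RHS]nth_default ?size_map -?eq_m // subnn /=.
      have : (m < size w)%N by rewrite -eq_m.
      case: w eq_m @p => // a w' eq_m _ lt_m.
      by rewrite (nth_map a) // (gP _).2.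
  - case: w @p => [|a w'] _ /=; first by rewrite l2.
    by rewrite l2 (gP a).1.
  - by rewrite NegzS_add1 l2 l1.
have : shift_of (G_of M) (fun k => label (p k)) by rewrite -shiftE; exists p.
move=> /shift_of_GP[v vP].
(* The [Lhd] just before position 0 fixes the automaton [i] and puts the path at its start state. *)
have := vP (Negz 0); rewrite /= lL.
rewrite -[(Negz 0 + 1)%R]/(0%R : int).
case: (v (Negz 0)) => [[[i q0]|]|] //= /eqP v0.
have run m : (m <= size w)%N ->
    v (Posz m) = inM i (foldl (@delta Sigma (M i)) (start (M i)) (take m w)).
  elim: m => [|m IHm] lt_m; first by rewrite take0 v0.
  have := vP (Posz m); rewrite -PoszD addn1 (IHm (ltnW lt_m)) /=.
  case E: w lt_m => [|a w'] // lt_m; rewrite -E in lt_m *.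
  by rewrite (nth_map a) // gE (take_nth a) // foldl_rcons => /eqP.
have := vP (Posz (size w)); rewrite (run _ (leqnn _)) /=.
rewrite nth_default ?size_map // subnn /= rR take_size => /andP[wi _].
by exists i.
Qed.

End TwoVertices.
End Construction.

Theorem theorem4p17 (Sigma : finType) (n : nat) (hn : (0 < n)%N)
    (M : 'I_n -> dfa Sigma) :
  \bigcup_(i : 'I_n) language (M i) = [set: seq Sigma] <->
  exists P : lgraph (symbol Sigma),
    [/\ presentation P (shift_of (G_of M)),
        deterministic P
      & #|vertex P| = 2%N].
Proof.
split=> [langT|[P [Ppres _ P2]]]; last exact: presentation_language Ppres P2.
exists (collapsed_graph Sigma); split.
- exact: collapsed_presentation.
- by move=> e f _.
- exact: card_bool.
Qed.
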